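(* Let $n,\gamma,\delta$ be positive integers such that $m:=\gamma n/\delta$ is an integer. For all integers $0\le s\le n$ and $1\le m_1\le m-1$, the cutsize distribution $A(s,m_1)$ of the ensemble $\mathrm{E}(n,\gamma,\delta)$ is $$A(s,m_1)=\frac{\binom{m}{m_1}\binom{n}{s}}{\binom{\delta m}{\delta m_1}}\;\mathrm{coef}\bigl(p(u)^{s}\,q(u)^{n-s},\,u^{\delta m_1}\bigr)\;\mathbb{I}[s\le\delta m_1]\;\mathbb{I}[s\le\delta(m-m_1)],$$ where $p(u):=(1+u)^{\gamma}-1-u^{\gamma}$ and $q(u):=1+u^{\gamma}$.
   Context: $\mathrm{coef}(f(x),x^i)$ is the coefficient of $x^i$ in the polynomial $f(x)$; $\mathbb{I}[P]=1$ if $P$ is true and $0$ otherwise. Ensemble $\mathrm{E}(n,\gamma,\delta)$: there are $n$ variable nodes, each with $\gamma$ sockets, and $m=\gamma n/\delta$ check nodes, each with $\delta$ sockets; put $\xi:=\gamma n=\delta m$. For each permutation $\pi$ of $\{1,\dots,\xi\}$, the $i$-th variable-side socket is joined by an edge to the $\pi(i)$-th check-side socket, giving a bipartite (multi)graph (Tanner graph). All $\xi!$ permutations are equally likely. Each Tanner graph gives a hypergraph $\mathcal{H}$ whose vertices are the $m$ check nodes and whose $n$ nets (counted with multiplicity) are the variable nodes; a vertex belongs to a net iff the check node and the variable node are joined by at least one edge. A bipartition is a pair $\Pi_2=(\mathcal{U}_1,\mathcal{U}_2)$ of non-empty disjoint subsets of the vertex set whose union is the whole vertex set, where the first part $\mathcal{U}_1$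 is distinguished. A net is a cut if it contains vertices of both parts; $\mathcal{X}(\Pi_2)$ is the set of cuts. $A_{\mathcal{H}}(s,m_1)$ is the number of bipartitions of $\mathcal{H}$ with $|\mathcal{X}(\Pi_2)|=s$ and $|\mathcal{U}_1|=m_1$, and $$A(s,m_1):=\frac1{\xi!}\sum_{\mathcal{H}\in\mathrm{E}(n,\gamma,\delta)}A_{\mathcal{H}}(s,m_1),$$ the sum being over all $\xi!$ permutations. *)

(* Defs.v *)
From mathcomp Require Import all_boot all_order all_algebra all_fingroup.
Set Implicit Arguments.
Unset Strict Implicit.
Unset Printing Implicit Defensive.
Import GRing.Theory.

(* Vertices form the finite type V; nets form a family indexed by the finite
   type E, so equal nets with different indices are counted separately. *)
Definition hypergraph (V E : finType) := E -> {set V}.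

Definition is_bipartition (V : finType) (P : {set V} * {set V}) : bool :=
  [&& P.1 != set0, P.2 != set0, [disjoint P.1 & P.2] & P.1 :|: P.2 == setT].

Definition cuts (V E : finType) (H : hypergraph V E)
    (P : {set V} * {set V}) : {set E} :=
  [set e | (H e :&: P.1 != set0) && (H e :&: P.2 != set0)].

Definition num_bipartitions (V E : finType) (H : hypergraph V E)
    (s m1 : nat) : nat :=
  #|[set P : {set V} * {set V} |
      [&& is_bipartition P, #|cuts H P| == s & #|P.1| == m1]]|.

(* Meaningful when delta > 0 divides gamma * n. *)
Definition num_checks (n gamma delta : nat) : nat := gamma * n %/ delta.

(* Sockets on either side are numbered from 0 to gamma * n - 1, node by node:
   variable-side socket i belongs to variable node i %/ gamma, and check-side
   socket j to check node j %/ delta.  An edge is named by its variable-side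
   socket, so this is the set of parallel edges joining v and c. *)
Definition tanner_edges (n gamma delta : nat) (pi : 'S_(gamma * n))
    (v : 'I_n) (c : 'I_(num_checks n gamma delta)) : {set 'I_(gamma * n)} :=
  [set i : 'I_(gamma * n) | (i %/ gamma == v) && (pi i %/ delta == c)].

Definition tanner_hypergraph (n gamma delta : nat) (pi : 'S_(gamma * n)) :
    hypergraph 'I_(num_checks n gamma delta) 'I_n :=
  fun v => [set c | tanner_edges pi v c != set0].

Local Open Scope ring_scope.

Definition cutsize_distribution (n gamma delta s m1 : nat) : rat :=
  ((gamma * n)`!%:R)^-1 *
  \sum_(pi : 'S_(gamma * n))
     (num_bipartitions (@tanner_hypergraph n gamma delta pi) s m1)%:R.

Definition p_poly (gamma : nat) : {poly rat} := (1 + 'X) ^+ gamma - 1 - 'X^gamma.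

Definition q_poly (gamma : nat) : {poly rat} := 1 + 'X^gamma.

(* Main.v *)
(* Fix U with #|U| = m1 and let B be the delta * m1 check-side sockets of U. A
   variable node is cut by (U, ~: U) iff A := pi^-1(B) contains some, but not
   all, of its gamma sockets, so only A matters. For a uniformly random pi, A is
   a uniformly random set of size #|B|. The sets A with s cut nodes are counted
   by choosing the cut nodes and multiplying generating functions: a cut node
   contributes p(u) and every other node q(u). The two indicators are redundant:
   each cut node has a socket in A and one outside A. *)
Require Import Defs.
From mathcomp Require Import all_boot all_order all_algebra all_fingroup.
Set Implicit Arguments.
Unset Strict Implicit.
Unset Printing Implicit Defensive.
Import GRing.Theory Num.Theory.
Local Open Scope ring_scope.

(** * Sets decomposed along the fibers of a map *)

Definition fiber (T I : finType) (h : T -> I) (v : I) : {set T} :=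
  [set x | h x == v].

(** When [h] sends each variable-side socket to its node and [A] holds the sockets joined to [U],
    these are the nodes cut by [U]. *)
Definition split_fibers (T I : finType) (h : T -> I) (A : {set T}) : {set I} :=
  [set v | (A :&: fiber h v != set0) && (A :&: fiber h v != fiber h v)].

(** A set amounts to a free choice of its trace on each fiber, so the right side expands by
    distributivity into the left one. *)
Lemma sum_prod_fibers (R : comPzRingType) (T I : finType) (h : T -> I)
    (F : I -> {set T} -> R) :
  \sum_(A : {set T}) \prod_v F v (A :&: fiber h v) =
  \prod_v \sum_(a : {set T} | a \subset fiber h v) F v a.
Proof.
rewrite bigA_distr_big_dep.
rewrite (reindex_onto (fun A => [ffun v => A :&: fiber h v])
  (fun f : {ffun I -> {set T}} => [set x | x \in f (h x)])).
  apply: eq_big => [A|A _]; last by apply: eq_bigr => v _; rewrite ffunE.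
  symmetry; apply/andP; split.
    by apply/familyP => v; rewrite ffunE unfold_in subsetIr.
  by apply/eqP/setP => x; rewrite !inE ffunE !inE eqxx andbT.
move=> f /familyP f_sub; apply/ffunP => v; rewrite ffunE.
apply/setP => x; rewrite !inE; case: eqP => [<-|neq]; rewrite ?andbT ?andbF //.
by symmetry; apply/negP => /(subsetP (f_sub v)); rewrite inE => /eqP.
Qed.

Lemma card_fibers (T I : finType) (h : T -> I) (A : {set T}) :
  #|A| = (\sum_v #|A :&: fiber h v|)%N.
Proof.
rewrite -sum1_card (partition_big h xpredT) //=.
by apply: eq_bigr => v _; rewrite -sum1_card; apply: eq_bigl => x; rewrite !inE.
Qed.

Lemma sum_Xcard_subsets (R : comNzRingType) (T : finType) (D : {set T}) :
  \sum_(a : {set T} | a \subset D) 'X^#|a| = (1 + 'X) ^+ #|D| :> {poly R}.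
Proof.
rewrite exprDn.
rewrite (partition_big (fun a : {set T} => inord #|a| : 'I_(#|D|.+1)) xpredT) //=.
apply: eq_bigr => k _; rewrite expr1n mul1r -[in RHS]cards_draws -sumr_const.
apply: eq_big => a; last first.
  by case/andP=> aD /eqP<-; rewrite inordK // ltnS subset_leq_card.
rewrite inE; case aD: (a \subset D) => //=.
by rewrite -val_eqE /= inordK // ltnS subset_leq_card.
Qed.

(** Only [set0] and [D] are unsplit, with terms 1 and X^#|D|; they differ since [D] is non-empty.
    The second sum is what remains of (1 + X)^#|D|. *)
Lemma sum_Xcard_split (T : finType) (D : {set T}) : (0 < #|D|)%N ->
  \sum_(a : {set T} | (a \subset D) && ~~ ((a != set0) && (a != D))) 'X^#|a|
    = q_poly #|D| /\
  \sum_(a : {set T} | (a \subset D) && ((a != set0) && (a != D))) 'X^#|a|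
    = p_poly #|D|.
Proof.
move=> D_gt0; have D_neq0 : D != set0 by rewrite -card_gt0.
have qE : \sum_(a : {set T} | (a \subset D) && ~~ ((a != set0) && (a != D)))
    'X^#|a| = q_poly #|D|.
  rewrite (bigD1 set0) ?sub0set ?eqxx //= cards0 expr0.
  rewrite (bigD1 D) /= ?subxx ?eqxx ?andbF // big_pred0 ?addr0 // => a.
  by case: (a == set0); case: (a == D); rewrite ?andbF.
split=> //.
have := @sum_Xcard_subsets rat T D.
rewrite (bigID (fun a => (a != set0) && (a != D))) /= qE /p_poly /q_poly => <-.
by rewrite -addrA -opprD addrK.
Qed.

Lemma sum_Xcard_split_fibers (T I : finType) (h : T -> I) (gamma : nat)
    (S : {set I}) :
  (0 < gamma)%N -> (forall v, #|fiber h v| = gamma) ->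
  \sum_(A : {set T} | split_fibers h A == S) 'X^#|A| =
  p_poly gamma ^+ #|S| * q_poly gamma ^+ (#|I| - #|S|).
Proof.
move=> gamma_gt0 hE.
(* [F v] kills every trace that is split or unsplit against what [S] prescribes at [v], so the
   product over [v] is X^#|A| if [S] is the split set of [A], and 0 otherwise. *)
pose F v (a : {set T}) : {poly rat} :=
  if (v \in S) == ((a != set0) && (a != fiber h v)) then 'X^#|a| else 0.
transitivity (\sum_(A : {set T}) \prod_v F v (A :&: fiber h v)).
  rewrite big_mkcond; apply: eq_bigr => A _; case: eqP => [defS|neq].
    rewrite [in LHS](card_fibers h A) -prodrXr; apply: eq_bigr => v _.
    by rewrite /F -defS inE eqxx.
  case: (pickP (fun v => (v \in S) != (v \in split_fibers h A))) => [v|eqS].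
    rewrite inE => /negbTE neqv.
    by rewrite (bigD1 v) //= {1}/F neqv mul0r.
  by case: neq; apply/setP => v; have /negbFE/eqP := eqS v.
rewrite sum_prod_fibers (bigID (mem S)) /= -(cardsC S) addKn.
congr (_ * _); rewrite -prodr_const; last first.
  apply: eq_big => [v|v /negbTE vS]; first by rewrite inE.
  rewrite -(hE v) -(proj1 (@sum_Xcard_split _ (fiber h v) _)) ?hE //.
  rewrite -big_mkcondr /=; apply: eq_bigl => a; rewrite vS.
  by case: (_ && _).
apply: eq_bigr => v vS.
rewrite -(hE v) -(proj2 (@sum_Xcard_split _ (fiber h v) _)) ?hE //.
by rewrite -big_mkcondr /=; apply: eq_bigl => a; rewrite vS; case: (a != _).
Qed.

(** All sets [S] of [s] split fibers give the same polynomial; its coefficient at [k] selects the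
    sets [A] of size [k]. *)
Lemma card_split_fibers (T I : finType) (h : T -> I) (gamma : nat)
    (s k : nat) :
  (0 < gamma)%N -> (forall v, #|fiber h v| = gamma) ->
  #|[set A : {set T} | (#|A| == k) && (#|split_fibers h A| == s)]|%:R =
  'C(#|I|, s)%:R * (p_poly gamma ^+ s * q_poly gamma ^+ (#|I| - s))`_k.
Proof.
move=> gamma_gt0 hE.
transitivity
  ((\sum_(A : {set T} | #|split_fibers h A| == s) 'X^#|A| : {poly rat})`_k).
  rewrite coef_sum -sum1dep_card natr_sum big_mkcondl /=.
  by apply: eq_bigr => A _; rewrite coefXn eq_sym; case: eqP.
rewrite (partition_big (split_fibers h) (fun S => #|S| == s)) //=.
rewrite (eq_bigr (fun=> p_poly gamma ^+ s * q_poly gamma ^+ (#|I| - s))).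
  rewrite sumr_const coefMn mulr_natl -card_draws.
  by congr (_ *+ _); apply: eq_card => S; rewrite inE.
move=> S /eqP <-; rewrite -(@sum_Xcard_split_fibers _ _ h gamma) //.
apply: eq_bigl => A.
by rewrite andbC; case: eqP => //= ->; rewrite eqxx.
Qed.

(** * Preimages of a set under a uniformly random permutation *)

Lemma perm_preimset_transitive (T : finType) (A B : {set T}) :
  #|A| = #|B| -> exists t : {perm T}, t @^-1: A = B.
Proof.
move=> AB.
pose e (D : {set T}) := enum D ++ enum (~: D).
have e_uniq D : uniq (e D).
  rewrite cat_uniq !enum_uniq andbT /=; apply/hasPn => x.
  by rewrite !mem_enum inE.
have size_e D : size (e D) = #|T| by rewrite size_cat -!cardE cardsC.
have e_all D x : x \in e D by rewrite mem_cat !mem_enum inE orbN.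
(* [f] matches the lists of [B] and of [A] place by place, complements coming last; equal sizes make
   the blocks line up. *)
pose f x := nth x (e A) (index x (e B)).
have lt_index x : (index x (e B) < size (e A))%N.
  by rewrite size_e -(size_e B) index_mem.
have f_inj : injective f.
  (* The default of [nth] is the argument itself, so the two defaults are first made equal; no index
     is out of range. *)
  move=> x y; rewrite /f (set_nth_default y) // => /eqP.
  rewrite nth_uniq // => /eqP eq_xy.
  by rewrite -(nth_index x (e_all B x)) eq_xy nth_index.
exists (perm f_inj); apply/setP => x; rewrite inE permE /f nth_cat -cardE AB.
have -> : (index x (e B) < #|B|)%N = (x \in B).
  rewrite index_cat mem_enum; case: ifP => xB; last first.
    by apply/negbTE; rewrite -leqNgt -cardE leq_addr.
  by rewrite cardE index_mem mem_enum.
case: ifP => xB.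
  rewrite -mem_enum mem_nth // -cardE AB cardE.
  by rewrite index_cat mem_enum xB index_mem mem_enum.
have : nth x (enum (~: A)) (index x (e B) - #|B|) \in enum (~: A).
  rewrite mem_nth // -cardE ltn_subLR.
    by rewrite -AB cardsC -(size_e B) index_mem.
  by rewrite index_cat mem_enum xB -cardE leq_addr.
by rewrite mem_enum inE => /negbTE.
Qed.

(* Double counting: the sum over permutations is the same for all sets with as
   many elements as B, and summing it over these sets gives the right side. *)
Lemma sum_perm_preimset (R : comPzRingType) (T : finType) (f : {set T} -> R)
    (B : {set T}) :
  'C(#|T|, #|B|)%:R * (\sum_(t : {perm T}) f (t @^-1: B)) =
  #|T|`!%:R * \sum_(A : {set T} | #|A| == #|B|) f A.
Proof.
transitivity
  (\sum_(A : {set T} | #|A| == #|B|) \sum_(t : {perm T}) f (t @^-1: A)).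
  rewrite mulr_natl -card_draws -sumr_const.
  apply: eq_big => [A|A]; rewrite inE // => /eqP AB.
  have [r <-] := @perm_preimset_transitive _ A B AB.
  (* Right translation by [r] turns preimages of [A] into preimages of [r @^-1: A], which is [B]. *)
  rewrite [RHS](reindex_inj (mulIg r)) /=; apply: eq_bigr => t _.
  by congr f; apply/setP => x; rewrite !inE permM.
rewrite exchange_big /= -cardsT -card_Sym mulr_natl -sumr_const /=.
apply: eq_big => [t|t _].
  by symmetry; rewrite inE; apply/subsetP.
have preim_inj : injective (fun A : {set T} => t @^-1: A).
  move=> A A' /setP eqA; apply/setP => x.
  by have := eqA (t^-1 x)%g; rewrite !inE permKV.
rewrite [RHS](reindex_inj preim_inj) /=.
by apply: eq_bigl => A; rewrite card_preimset //; exact: perm_inj.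
Qed.

(** * Sizes of fibers, of preimages and of split sets *)

Lemma card_ord_divn (N d m v : nat) : N = (d * m)%N -> (v < m)%N ->
  #|[set i : 'I_N | i %/ d == v]%N| = d.
Proof.
move=> -> lt_vm; have [->|d_gt0] := posnP d.
  by apply: eq_card0 => -[].
have lt_f (j : 'I_d) : (v * d + j < d * m)%N.
  apply: (@leq_trans (v.+1 * d)); first by rewrite mulSn addnC ltn_add2r.
  by rewrite mulnC leq_mul2l lt_vm orbT.
pose f j := Ordinal (lt_f j).
have f_inj : injective f by move=> j j' [/addnI]; exact: val_inj.
rewrite -[RHS]card_ord -(card_imset _ f_inj); apply: eq_card => i; rewrite inE.
apply/eqP/imsetP => [iv|[j _ ->]]; last by rewrite divnMDl // divn_small ?addn0.
exists (Ordinal (ltn_pmod i d_gt0)) => //.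
by apply: val_inj; rewrite /= -iv -divn_eq.
Qed.

(** Gives the map from sockets to nodes, for the variable side and the check side alike. *)
Lemma ord_divn_fibers (N d m : nat) : N = (d * m)%N -> (0 < d)%N ->
  exists h : 'I_N -> 'I_m,
    (forall i, h i = (i %/ d)%N :> nat) /\ (forall v, #|fiber h v| = d).
Proof.
move=> NE d_gt0.
have lt_div (i : 'I_N) : (i %/ d < m)%N by rewrite ltn_divLR // mulnC -NE.
exists (fun i => Ordinal (lt_div i)); split=> // v.
by rewrite -[RHS](@card_ord_divn N d m v) //; apply: eq_card => i.
Qed.

Lemma card_preimset_fibers (T I : finType) (h : T -> I) (d : nat) (U : {set I}) :
  (forall v, #|fiber h v| = d) -> #|h @^-1: U| = (d * #|U|)%N.
Proof.
move=> hE; rewrite (card_fibers h) mulnC -sum_nat_const [RHS]big_mkcond /=.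
apply: eq_bigr => v _; case: ifP => vU.
  rewrite -(hE v); apply: eq_card => x; rewrite !inE.
  by case: eqP => [->|]; rewrite ?vU ?andbF.
apply: eq_card0 => x; rewrite !inE.
by case: eqP => [->|]; rewrite ?vU ?andbF.
Qed.

(** The split set lies in the images under [h] of [A] and of its complement. This yields the two
    indicators. *)
Lemma leq_card_split_fibers (T I : finType) (h : T -> I) (A : {set T}) :
  (#|split_fibers h A| <= #|A|)%N /\ (#|split_fibers h A| <= #|~: A|)%N.
Proof.
split; apply: leq_trans (leq_imset_card h _); apply/subset_leq_card/subsetP;
  move=> v; rewrite inE => /andP[].
  by case/set0Pn => x; rewrite !inE => /andP[xA /eqP <-] _; exact: imset_f.
move=> _; rewrite eqEsubset subsetIr => /subsetPn[x].
by rewrite !inE => /eqP <-; rewrite eqxx andbT => xA; rewrite imset_f // inE.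
Qed.

(** * Bipartitions and cut nets in terms of one vertex set *)

Lemma num_bipartitionsE (V E : finType) (H : hypergraph V E) (s m1 : nat) :
  (0 < m1 < #|V|)%N ->
  num_bipartitions H s m1 =
  #|[set U : {set V} | (#|U| == m1) && (#|cuts H (U, ~: U)| == s)]|.
Proof.
case/andP=> m1_gt0 m1_lt; pose f (U : {set V}) := (U, ~: U).
have f_inj : injective f by move=> U U' [].
rewrite /num_bipartitions -(card_imset _ f_inj); apply: eq_card => -[U W].
(* Disjointness and covering force [W] to be [~: U]; conversely, the bounds on [m1] make both parts
   non-empty. *)
rewrite inE /is_bipartition /=; apply/idP/imsetP => [|[U']].
  case/and3P=> /and4P[_ _ dis /eqP cov] cutE U1.
  have defW : W = ~: U.
    apply/setP => x; have := in_setT x; rewrite -cov !inE.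
    by case xU: (x \in U) => //=; rewrite (disjointFr dis xU).
  by exists U; rewrite ?inE ?U1 /f -?defW ?cutE.
rewrite inE => /andP[/eqP U1 cutE] [-> ->].
rewrite -card_gt0 U1 m1_gt0 -card_gt0 cutE eqxx -setI_eq0 setICr eqxx setUCr eqxx.
by rewrite -(ltn_add2l #|U'|) addn0 cardsC U1 m1_lt.
Qed.

(** The net of [v] meets [~: U] iff some socket of [v] is not joined to a socket of [U], that is,
    iff the trace is not the whole fiber. *)
Lemma cuts_tanner (n gamma delta : nat) (pi : 'S_(gamma * n))
    (var : 'I_(gamma * n) -> 'I_n)
    (chk : 'I_(gamma * n) -> 'I_(num_checks n gamma delta))
    (U : {set 'I_(num_checks n gamma delta)}) :
  (forall i, var i = (i %/ gamma)%N :> nat) ->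
  (forall i, chk i = (i %/ delta)%N :> nat) ->
  cuts (@tanner_hypergraph n gamma delta pi) (U, ~: U) =
  split_fibers var (pi @^-1: (chk @^-1: U)).
Proof.
move=> varE chkE.
have edgeP v (W : {set _}) :
    (@tanner_hypergraph n gamma delta pi v :&: W != set0) =
    (pi @^-1: (chk @^-1: W) :&: fiber var v != set0).
  apply/set0Pn/set0Pn => [[c]|[i]]; rewrite !inE.
    case/andP=> /set0Pn[i]; rewrite inE -varE -chkE !val_eqE.
    by case/andP=> vi /eqP <- cW; exists i; rewrite !inE cW.
  case/andP=> cW vi; exists (chk (pi i)); rewrite !inE cW andbT.
  by apply/set0Pn; exists i; rewrite inE -varE -chkE !val_eqE vi eqxx.
apply/setP => v; rewrite [LHS]inE [RHS]inE !edgeP; congr (_ && _).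
rewrite [in RHS]eqEsubset subsetIr /=.
apply/set0Pn/subsetPn => [[i]|[i vi]]; rewrite !inE.
  by case/andP=> /negbTE iU vi; exists i; rewrite ?inE ?iU.
rewrite inE in vi; rewrite vi andbT => iU.
by exists i; rewrite !inE iU vi.
Qed.

Theorem theorem1 (n gamma delta : nat)
    (n_gt0 : (0 < n)%N) (gamma_gt0 : (0 < gamma)%N) (delta_gt0 : (0 < delta)%N)
    (delta_dvd : (delta %| gamma * n)%N) :
  let m := num_checks n gamma delta in
  forall s m1 : nat,
    (0 <= s <= n)%N -> (1 <= m1 <= m - 1)%N ->
    cutsize_distribution n gamma delta s m1 =
      'C(m, m1)%:R * 'C(n, s)%:R / 'C(delta * m, delta * m1)%:R
      * (p_poly gamma ^+ s * q_poly gamma ^+ (n - s))`_(delta * m1)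
      * (s <= delta * m1)%N%:R
      * (s <= delta * (m - m1))%N%:R.
Proof.
move=> m s m1 _ /andP[m1_gt0 m1_le].
have m1_lt : (m1 < m)%N.
  (* For m = 0 the truncated m - 1 is 0, against m1 >= 1. *)
  by case: (m) m1_le => [|m1_]; rewrite ?subn1 // leqNgt m1_gt0.
have NE : (gamma * n = delta * m)%N by rewrite [RHS]mulnC divnK.
have [var [varE var_fiber]] := @ord_divn_fibers _ gamma n erefl gamma_gt0.
have [chk [chkE chk_fiber]] := @ord_divn_fibers _ delta m NE delta_gt0.
pose f (A : {set 'I_(gamma * n)}) : rat := (#|split_fibers var A| == s)%:R.
pose k := (delta * m1)%N.
pose c : rat := 'C(n, s)%:R * (p_poly gamma ^+ s * q_poly gamma ^+ (n - s))`_k.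
have cE : \sum_(A : {set 'I_(gamma * n)} | #|A| == k) f A = c.
  rewrite /c; have := @card_split_fibers _ _ var gamma s k gamma_gt0 var_fiber.
  rewrite card_ord => <-; rewrite -sum1dep_card natr_sum big_mkcondr /=.
  by apply: eq_bigr => A _; rewrite /f; case: (_ == _).
have c_ind : c * (s <= k)%N%:R * (s <= delta * (m - m1))%N%:R = c.
  (* Each non-zero term has [s] split nodes, where [A] has [k] elements and its complement delta *
     (m - m1), so both inequalities hold. *)
  rewrite -cE -mulrA -natrM mulnb mulr_suml; apply: eq_bigr => A /eqP Ak.
  rewrite /f; case: eqP => [<-|]; rewrite ?mul0r ?mul1r //.
  have [leA leCA] := leq_card_split_fibers var A.
  rewrite -Ak leA mulnBr -NE -[X in (X - _)%N]card_ord -/k -Ak.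
  by rewrite -(cardsC A) addKn leCA.
have sum_perm (U : {set 'I_m}) : #|U| = m1 ->
    \sum_(pi : 'S_(gamma * n)) f (pi @^-1: (chk @^-1: U)) =
    (gamma * n)`!%:R * c / 'C(delta * m, k)%:R.
  move=> Um1; have := sum_perm_preimset f (chk @^-1: U).
  rewrite (card_preimset_fibers _ chk_fiber) Um1 -/k cE card_ord -NE => <-.
  rewrite mulrC mulKf // pnatr_eq0 -lt0n bin_gt0.
  by rewrite NE leq_mul2l (ltnW m1_lt) orbT.
have -> : cutsize_distribution n gamma delta s m1 =
    ((gamma * n)`!%:R)^-1 * \sum_(U : {set 'I_m} | #|U| == m1)
      \sum_(pi : 'S_(gamma * n)) f (pi @^-1: (chk @^-1: U)).
  rewrite exchange_big /=; congr (_ * _); apply: eq_bigr => pi _.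
  rewrite num_bipartitionsE ?card_ord ?m1_gt0 //.
  rewrite -sum1dep_card natr_sum big_mkcondr /=; apply: eq_bigr => U _.
  by rewrite (cuts_tanner _ _ varE chkE) /f; case: (_ == _).
(* The inner sum is the same for each of the ['C(m, m1)] sets [U]; its factorial cancels the
   normalising one. *)
rewrite (eq_bigr _ (fun U Um1 => sum_perm U (eqP Um1))) sumr_const.
have -> : #|[pred U : {set 'I_m} | #|U| == m1]| = 'C(m, m1).
  rewrite -[X in 'C(X, _)]card_ord -card_draws.
  by apply: eq_card => U; rewrite !inE.
rewrite -c_ind -[(_ / _) *+ _]mulr_natl -!mulrA mulrCA.
rewrite mulKf ?pnatr_eq0 -?lt0n ?fact_gt0 //.
do 2! congr (_ * _).
by rewrite [RHS]mulrC -!mulrA.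
Qed.
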